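(* Let $m\ge1$ and let $\mathcal A(x)=\sum_{n\ge0}a_n\frac{x^n}{n!}$ be the exponential generating function (a formal power series) of a sequence $(a_n)_{n\ge0}$ satisfying $$a_{n+m}=\sum_{k=0}^n\binom nk m^{\,n-k}a_k\qquad(n\ge0).$$ Then $\mathcal A$ satisfies the $m$-th order ordinary differential equation $$\Big(\frac{d}{dx}\Big)^m\mathcal A(x)-e^{mx}\mathcal A(x)=0.$$ *)

(* Defs.v *)
From mathcomp Require Import all_boot all_order all_algebra.

Set Implicit Arguments.
Unset Strict Implicit.
Unset Printing Implicit Defensive.

Import GRing.Theory.
Local Open Scope ring_scope.

(* Formal power series  \sum_(n >= 0) A_n x^n,  given by their coefficients. The
   wrapper keeps [nat -> R] from bringing in pointwise operations. Leibniz
   equality is coefficientwise equality, by functional extensionality. *)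
Record fps (R : Type) := FPS { fps_coef : nat -> R }.

Section Operations.
Variable R : pzRingType.
Implicit Types A B : fps R.

Definition fps_zero : fps R := FPS (fun=> 0).

Definition fps_sub A B : fps R :=
  FPS (fun n => fps_coef A n - fps_coef B n).

Definition fps_mul A B : fps R :=
  FPS (fun n => \sum_(i < n.+1) fps_coef A i * fps_coef B (n - i)%N).

Definition fps_deriv A : fps R :=
  FPS (fun n => fps_coef A n.+1 *+ n.+1).

End Operations.

Arguments fps_zero {R}.

Section Exponential.
Variable F : fieldType.

(* Division by n! is meaningful only when F has characteristic 0. *)
Definition egf (a : nat -> F) : fps F := FPS (fun n => a n / n`!%:R).

(* The formal power series e^{cx}. *)
Definition fps_exp (c : F) : fps F := FPS (fun n => c ^+ n / n`!%:R).

End Exponential.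

(* Main.v *)
Require Import Defs.
From mathcomp Require Import all_boot all_order all_algebra.
From Stdlib Require Import FunctionalExtensionality.

Import GRing.Theory.
Local Open Scope ring_scope.

(** Under the correspondence between sequences and exponential generating
    functions, differentiation is the shift of the sequence ([iter_deriv_egf])
    and the product is the binomial convolution ([fps_mul_egf]). Since
    [e^{mx}] is the generating function of the powers of [m], the recurrence
    says exactly that the [m]-fold shift of [a] is the binomial convolution of
    these powers with [a], which is the differential equation read off
    coefficientwise. Characteristic 0 enters because the factorials must be
    invertible. *)

Lemma natr_fact_neq0 (F : fieldType) (n : nat) :
  [pchar F] =i pred0 -> n`!%:R != 0 :> F.
Proof. by move/pcharf0P=> ->; rewrite -lt0n fact_gt0. Qed.

Lemma deriv_egf (F : fieldType) (charF0 : [pchar F] =i pred0) (a : nat -> F) :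
  fps_deriv (egf a) = egf (fun n => a n.+1).
Proof.
congr FPS; apply: functional_extensionality => n /=.
have n1_neq0 : n.+1%:R != 0 :> F by move/pcharf0P: charF0 => ->.
by rewrite -[LHS]mulr_natr factS natrM invfM mulrA mulrAC divfK.
Qed.

Lemma iter_deriv_egf (F : fieldType) (charF0 : [pchar F] =i pred0)
    (m : nat) (a : nat -> F) :
  iter m (@fps_deriv F) (egf a) = egf (fun n => a (n + m)%N).
Proof.
elim: m => [|m IHm] /=.
  by congr egf; apply: functional_extensionality => n; rewrite addn0.
rewrite IHm deriv_egf //; congr egf.
by apply: functional_extensionality => n; rewrite addnS.
Qed.

(** This is the identity [1/(i! (n-i)!) = C(n,i)/n!]. The sum is indexed by the
    argument of the second factor, whereas the Cauchy product is indexed by that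
    of the first one, hence the reversal of the sum. *)
Lemma fps_mul_egf (F : fieldType) (charF0 : [pchar F] =i pred0)
    (b a : nat -> F) :
  fps_mul (egf b) (egf a) =
  egf (fun n => \sum_(0 <= k < n.+1) 'C(n, k)%:R * b (n - k)%N * a k).
Proof.
congr FPS; apply: functional_extensionality => n /=.
rewrite big_mkord mulr_suml (reindex_inj rev_ord_inj) /=.
apply: eq_bigr => k _; have le_kn : (k <= n)%N by rewrite -ltnS.
have fact_neq0 j := natr_fact_neq0 F j charF0.
rewrite subSS subKn // -(bin_fact le_kn) !natrM.
have bin_neq0 : 'C(n, k)%:R != 0 :> F.
  by move/pcharf0P: charF0 => ->; rewrite -lt0n bin_gt0.
rewrite mulf_div [k`!%:R * _]mulrC -['C(n, k)%:R * _ * _]mulrA.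
by rewrite -[RHS]mulf_div divff // mul1r.
Qed.

Theorem proposition2p1 (F : fieldType) (charF0 : [pchar F] =i pred0)
    (m : nat) (m_ge1 : (1 <= m)%N) (a : nat -> F)
    (a_rec : forall n : nat,
       a (n + m)%N =
         \sum_(0 <= k < n.+1) 'C(n, k)%:R * m%:R ^+ (n - k)%N * a k) :
  fps_sub (iter m (@fps_deriv F) (egf a))
          (fps_mul (fps_exp (m%:R : F)) (egf a)) = fps_zero.
Proof.
rewrite iter_deriv_egf //.
rewrite -[fps_exp _]/(egf (fun n => m%:R ^+ n)) fps_mul_egf //.
congr FPS; apply: functional_extensionality => n /=.
by rewrite a_rec subrr.
Qed.
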